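(* Let $p\in\mathbb{N}$, let $f_1,\dots,f_p\in\mathcal{C}$ be integrands on $[0,1)^d$, let $\boldsymbol{\mu}=(\mu_1,\dots,\mu_p)$ with $\mu_j=\int_{[0,1)^d}f_j(\boldsymbol{x})\,\mathrm{d}\boldsymbol{x}$, and let $v:\Omega\subseteq\mathbb{R}^p\to\mathbb{R}$ be a function with $\boldsymbol{\mu}\in\Omega$. The goal is the computation of $v(\boldsymbol{\mu})$. Let $(\varepsilon_{\mathrm{a}},\varepsilon_{\mathrm{r}})\in[0,\infty)\times[0,1)\setminus\{(0,0)\}$ and let the tolerance function be $$\mathrm{tol}(v,\hat v,\varepsilon_{\mathrm{a}},\varepsilon_{\mathrm{r}})=\frac{(v-\hat v)^2}{\max(\varepsilon_{\mathrm{a}}^2,\varepsilon_{\mathrm{r}}^2|v|^2)} .$$ For $n=2^m$ with $m\ge \ell_*+r$, let $\widehat{\boldsymbol{\mu}}_n=(\widehat\mu_{n,1},\dots,\widehat\mu_{n,p})$ be the vector of sample means and $\mathbf{err}_n=(\mathrm{err}_{n,1},\dots,\mathrm{err}_{n,p})$ the vector of data-based error bounds of $f_1,\dots,f_p$, and let $B_n=[\widehat{\boldsymbol{\mu}}_n-\mathbf{err}_n,\widehat{\boldsymbol{\mu}}_n+\mathbf{err}_n]=\prod_{j=1}^p[\widehat\mu_{n,j}-\mathrm{err}_{n,j},\ \widehat\mu_{n,j}+\mathrm{err}_{n,j}]$. Define the extreme possible values $$v_-=\inf_{\boldsymbol{\mu}'\in\Omega\cap B_n}v(\boldsymbol{\mu}'),\qquad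 v_+=\sup_{\boldsymbol{\mu}'\in\Omega\cap B_n}v(\boldsymbol{\mu}'),$$ and the approximation $$\hat v=\frac{v_-\max(\varepsilon_{\mathrm{a}},\varepsilon_{\mathrm{r}}|v_+|)+v_+\max(\varepsilon_{\mathrm{a}},\varepsilon_{\mathrm{r}}|v_-|)}{\max(\varepsilon_{\mathrm{a}},\varepsilon_{\mathrm{r}}|v_+|)+\max(\varepsilon_{\mathrm{a}},\varepsilon_{\mathrm{r}}|v_-|)} .$$ (i) $\hat v$ is the optimal approximation to $v(\boldsymbol{\mu})$, and the tolerance function for this optimal choice is given as follows: $$\inf_{\hat v'}\ \sup_{\boldsymbol{\mu}'\in\Omega\cap B_n}\mathrm{tol}(v(\boldsymbol{\mu}'),\hat v',\varepsilon_{\mathrm{a}},\varepsilon_{\mathrm{r}}) =\inf_{\hat v'}\ \sup_{v_-\le v'\le v_+}\mathrm{tol}(v',\hat v',\varepsilon_{\mathrm{a}},\varepsilon_{\mathrm{r}}) =\sup_{v_-\le v'\le v_+}\mathrm{tol}(v',\hat v,\varepsilon_{\mathrm{a}},\varepsilon_{\mathrm{r}})$$ $$=\mathrm{tol}(v_\pm,\hat v,\varepsilon_{\mathrm{a}},\varepsilon_{\mathrm{r}}) =\frac{(v_+-v_-)^2}{\left[\max(\varepsilon_{\mathrm{a}},\varepsilon_{\mathrm{r}}|v_+|)+\max(\varepsilon_{\mathrm{a}},\varepsilon_{\mathrm{r}}|v_-|)\right]^2}.$$ Here ''optimal'' means that the infimum over $\hat v'$ in the second expression is attained by $\hat v'=\hat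 v$, as the third expression asserts. Moreover, the supremum in the third expression is attained simultaneously at $v_+$ and $v_-$ (the fourth expression holds for both signs). (ii) The adaptive quasi-Monte Carlo cubature algorithm increases $n=2^m$ by incrementing $m$ by one until $$\frac{(v_+-v_-)^2}{\left[\max(\varepsilon_{\mathrm{a}},\varepsilon_{\mathrm{r}}|v_+|)+\max(\varepsilon_{\mathrm{a}},\varepsilon_{\mathrm{r}}|v_-|)\right]^2}\le 1 .$$ The resulting $\hat v$ then satisfies the error criterion $\mathrm{tol}(v(\boldsymbol{\mu}),\hat v,\varepsilon_{\mathrm{a}},\varepsilon_{\mathrm{r}})\le1$.
   Context: **Point sequences.** $\{\boldsymbol{0}=\boldsymbol{z}_0,\boldsymbol{z}_1,\dots\}\subset[0,1)^d$ is a sequence of distinct points that is either a base-2 digital sequence or a base-2 rank-1 lattice node sequence. It is a group under an addition $\oplus$ on $[0,1)^d$, and for every $m\in\mathbb{N}_0$ the first $2^m$ points form a subgroup. There is a set $\mathbb{K}$ of integer vector wavenumbers, which is a group under its own addition, also denoted $\oplus$, and a bilinear functional $\langle\cdot,\cdot\rangle:\mathbb{K}\times[0,1)^d\to\mathbb{R}$. - Digital case: $\oplus$ is digitwise addition modulo 2, for points and for wavenumbers in $\mathbb{K}=\mathbb{N}_0^d$; $\langle\boldsymbol{k},\boldsymbol{x}\rangle$ is one half of an inner product, modulo 2, of the binary digits of $\boldsymbol{k}$ and $\boldsymbol{x}$, so that the functions $e^{2\pi\sqrt{-1}\langle\boldsymbol{k},\cdot\rangle}$ are multivariate Walsh functions.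 - Lattice case: $\oplus$ is addition modulo $\boldsymbol{1}$ for points and ordinary addition on $\mathbb{K}=\mathbb{Z}^d$; $\langle\boldsymbol{k},\boldsymbol{x}\rangle=\boldsymbol{k}^T\boldsymbol{x}\bmod1$. For a fixed shift $\boldsymbol{\Delta}\in[0,1)^d$ the data sites are $\boldsymbol{x}_i=\boldsymbol{z}_i\oplus\boldsymbol{\Delta}$, $i\in\mathbb{N}_0$. The functions $e^{2\pi\sqrt{-1}\langle\boldsymbol{k},\cdot\rangle}$, $\boldsymbol{k}\in\mathbb{K}$, form a Fourier basis for $L^2[0,1)^d$. **Dual sets and ordering.** $\mathbb{K}_0=\mathbb{K}$ and $\mathbb{K}_m=\{\boldsymbol{k}\in\mathbb{K}:\langle\boldsymbol{k},\boldsymbol{z}_{2^\ell}\rangle=0,\ \ell=0,\dots,m-1\}$ for $m\in\mathbb{N}$; one has $2^{-m}\sum_{i=0}^{2^m-1}e^{2\pi\sqrt{-1}\langle\boldsymbol{k},\boldsymbol{z}_i\rangle}=1$ if $\boldsymbol{k}\in\mathbb{K}_m$ and $0$ otherwise. A fixed ordering of the wavenumbers $\tilde{\boldsymbol{k}}:\mathbb{N}_0\to\mathbb{K}$ satisfies $\tilde{\boldsymbol{k}}(0)=\boldsymbol{0}$ and $\{\tilde{\boldsymbol{k}}(\kappa+\lambda2^m)\}_{\lambda=0}^\infty=\tilde{\boldsymbol{k}}(\kappa)\oplus\mathbb{K}_m$ for $\kappa=0,\dots,2^m-1$, $m\in\mathbb{N}_0$. **Fourier coefficients.** $AC([0,1)^d)$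 is the set of functions $f$ with absolutely convergent Fourier series, i.e. $f(\boldsymbol{x})=\sum_{\boldsymbol{k}\in\mathbb{K}}\hat f(\boldsymbol{k})e^{2\pi\sqrt{-1}\langle\boldsymbol{k},\boldsymbol{x}\rangle}$ for all $\boldsymbol{x}\in[0,1)^d$, where $\hat f(\boldsymbol{k})=\int_{[0,1)^d}f(\boldsymbol{x})e^{-2\pi\sqrt{-1}\langle\boldsymbol{k},\boldsymbol{x}\rangle}\,\mathrm{d}\boldsymbol{x}$ and $\sum_{\boldsymbol{k}\in\mathbb{K}}|\hat f(\boldsymbol{k})|<\infty$. Discrete coefficients: $\tilde f_m(\boldsymbol{k})=2^{-m}\sum_{i=0}^{2^m-1}f(\boldsymbol{x}_i)e^{-2\pi\sqrt{-1}\langle\boldsymbol{k},\boldsymbol{x}_i\rangle}$. Write $\hat f_\kappa=\hat f(\tilde{\boldsymbol{k}}(\kappa))$, $\tilde f_{m,\kappa}=\tilde f_m(\tilde{\boldsymbol{k}}(\kappa))$. **Cone.** For $\ell,m\in\mathbb{N}_0$, $\ell\le m$: $S_m(f)=\sum_{\kappa=\lfloor2^{m-1}\rfloor}^{2^m-1}|\hat f_\kappa|$, $\ \widehat S_{\ell,m}(f)=\sum_{\kappa=\lfloor2^{\ell-1}\rfloor}^{2^\ell-1}\sum_{\lambda=1}^\infty|\hat f_{\kappa+\lambda2^m}|$, $\ \check S_m(f)=\sum_{\kappa=2^m}^\infty|\hat f_\kappa|$, $\ \widetilde S_{\ell,m}(f)=\sum_{\kappa=\lfloor2^{\ell-1}\rfloor}^{2^\ell-1}|\tilde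 f_{m,\kappa}|$. Fix a positive integer $\ell_*$ and bounded functions $\widehat\omega,\mathring\omega:\mathbb{N}_0\to[0,\infty)$ with $\mathring\omega(m)\to0$ as $m\to\infty$, and a fixed $r\in\mathbb{N}_0$ with $\widehat\omega(r)\mathring\omega(r)<1$. Then $$\mathcal{C}=\{f\in AC([0,1)^d):\ \widehat S_{\ell,m}(f)\le\widehat\omega(m-\ell)\check S_m(f)\ \text{for } \ell\le m;\ \ \check S_m(f)\le\mathring\omega(m-\ell)S_\ell(f)\ \text{for } \ell_*\le\ell\le m\}.$$ **Sample mean and data-based error bound.** For $n=2^m$, $m\ge\ell_*+r$: $\widehat\mu_n=\frac1n\sum_{i=0}^{n-1}f(\boldsymbol{x}_i)$ and $$\mathrm{err}_n=\frac{\widehat\omega(m)\mathring\omega(r)}{1-\widehat\omega(r)\mathring\omega(r)}\,\widetilde S_{m-r,m}(f).$$ For $f\in\mathcal{C}$ it is known that $\left|\int_{[0,1)^d} f(\boldsymbol{x})\,\mathrm{d}\boldsymbol{x}-\widehat\mu_n\right|\le\mathrm{err}_n$. For a vector of integrands, $\widehat\mu_{n,j}$ and $\mathrm{err}_{n,j}$ are these quantities for $f_j$, so that $\boldsymbol{\mu}\in[\widehat{\boldsymbol{\mu}}_n-\mathbf{err}_n,\widehat{\boldsymbol{\mu}}_n+\mathbf{err}_n]$ (componentwise) when all $f_j\in\mathcal{C}$.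
   Formalization: v is taken bounded on Ω∩B_n; digital shifts must give digitwise sums not ending in infinitely many ones (so ⟨·,·⟩ is bilinear); a/0=∞ for a>0, 0/0=0, and if ε_a=0 and v_+ or v_- is 0, tol(v_±,v̂)=0/0 is read as the limit v'→v_± in [v_-,v_+]. *)

(* Defs.v *)
From HB Require Import structures.
From mathcomp Require Import all_boot all_order all_algebra archimedean finmap.
From mathcomp Require Import complex.
From mathcomp Require Import all_classical all_reals all_analysis.
From mathcomp Require Import summability.

Set Implicit Arguments.
Unset Strict Implicit.
Unset Printing Implicit Defensive.

Import Order.TTheory GRing.Theory Num.Theory.
Import numFieldNormedType.Exports.
Import ComplexField.

Local Open Scope classical_set_scope.
Local Open Scope ring_scope.
Local Open Scope complex_scope.

(* [measurableTypeR R] is [R] with its Borel sigma-algebra; tuples over it carry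
   the product sigma-algebra. *)
Notation Rpoint R d := (d.-tuple (measurableTypeR R)).

(* d-dimensional Lebesgue measure, by recursion on d: the image of the product
   measure under (x, t) |-> x :: t. *)

Definition cons_point (R : realType) (d : nat)
    (u : measurableTypeR R * Rpoint R d) : Rpoint R d.+1 :=
  [tuple of u.1 :: u.2].

Lemma measurable_cons_point (R : realType) (d : nat) :
  measurable_fun setT (@cons_point R d).
Proof. exact: (measurable_cons measurable_fst measurable_snd). Qed.

Section lebesgue_cons.
Context (R : realType) (d : nat)
  (mu : {sigma_finite_measure set (Rpoint R d) -> \bar R}).

Definition lebesgue_cons : set (Rpoint R d.+1) -> \bar R :=
  pushforward ((@lebesgue_measure R) \x mu)%E (@cons_point R d).

Let m_cons (A : set (Rpoint R d.+1)) :
  measurable A -> measurable (@cons_point R d @^-1` A).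
Proof. by move=> mA; rewrite -[X in measurable X]setTI; exact: measurable_cons_point. Qed.

Let lebesgue_cons0 : lebesgue_cons set0 = 0%E.
Proof. by rewrite /lebesgue_cons /pushforward preimage_set0 measure0. Qed.

Let lebesgue_cons_ge0 A : (0 <= lebesgue_cons A)%E.
Proof. by rewrite /lebesgue_cons /pushforward; exact: measure_ge0. Qed.

Let lebesgue_cons_sigma_additive : semi_sigma_additive lebesgue_cons.
Proof.
move=> F mF tF mUF; rewrite /lebesgue_cons /pushforward preimage_bigcup.
apply: measure_semi_sigma_additive.
- by move=> n; exact: m_cons.
- apply/trivIsetP => /= i j _ _ ij; rewrite -preimage_setI.
  by move/trivIsetP : tF => /(_ _ _ _ _ ij) ->//; rewrite preimage_set0.
- by rewrite -preimage_bigcup; exact: m_cons.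
Qed.

HB.instance Definition _ := isMeasure.Build _ _ _ lebesgue_cons
  lebesgue_cons0 lebesgue_cons_ge0 lebesgue_cons_sigma_additive.

Let lebesgue_cons_sigma_finite : sigma_finite setT lebesgue_cons.
Proof.
have /sigma_finiteP[F [TF ndF Foo]] := sigma_finiteT (@lebesgue_measure R).
have /sigma_finiteP[G [TG ndG Goo]] := sigma_finiteT mu.
pose g (t : Rpoint R d.+1) : measurableTypeR R * Rpoint R d :=
  (thead t, [tuple of behead t]).
have mg : measurable_fun setT g.
  apply/measurable_fun_pairP; split; first exact: measurable_tnth.
  exact: measurable_behead.
have gK : cancel (@cons_point R d) g.
  by move=> [x t]; rewrite /g /cons_point /= theadE; congr pair; exact/val_inj.
exists (fun n => g @^-1` (F n `*` G n)).
  rewrite -preimage_bigcup (_ : \bigcup_n _ = setT) ?preimage_setT//.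
  rewrite -setXTT TF TG predeqE => -[x y]; split.
    by move=> [n _ []/= ? ?]; split; exists n.
  move=> [/= [n _ Fnx] [k _ Gky]]; exists (maxn n k) => //; split.
  - by move: x Fnx; exact/subsetPset/ndF/leq_maxl.
  - by move: y Gky; exact/subsetPset/ndG/leq_maxr.
move=> n; have [mF Fn] := Foo n; have [mG Gn] := Goo n; split.
  by rewrite -[_ @^-1` _]setTI; apply: mg => //; exact: measurableX.
rewrite /lebesgue_cons /pushforward -comp_preimage.
rewrite (_ : g \o _ = id) ?preimage_id; last exact/funext.
by rewrite product_measure1E// lte_mul_pinfty// ge0_fin_numE.
Qed.

HB.instance Definition _ := Measure_isSigmaFinite.Build _ _ _ lebesgue_cons
  lebesgue_cons_sigma_finite.

End lebesgue_cons.

Fixpoint lebesgue_point (R : realType) (d : nat) :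
    {sigma_finite_measure set (Rpoint R d) -> \bar R} :=
  if d is d'.+1 then lebesgue_cons (lebesgue_point R d')
  else \d_ ([tuple] : Rpoint R 0).

Definition cube (R : realType) (d : nat) : set (Rpoint R d) :=
  [set x | forall j, 0 <= (tnth x j : R) < 1].

Definition cube_int (R : realType) (d : nat) (f : Rpoint R d -> R) : R :=
  \int[lebesgue_point R d]_(x in @cube R d) f x.

Definition cube_cint (R : realType) (d : nat) (f : Rpoint R d -> R[i]) : R[i] :=
  cube_int (fun x => complex.Re (f x)) +i* cube_int (fun x => complex.Im (f x)).

Definition frac (R : realType) (x : R) : R := x - (Num.floor x)%:~R.

(* The binary digit of weight 2^-(l+1) of x in [0, 1), in the expansion that
   does not end in ones. *)
Definition bdigit (R : realType) (x : R) (l : nat) : bool :=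
  odd (Num.truncn (x * 2 ^+ l.+1)).

Definition digitwise_add (R : realType) (x y : R) : R :=
  frac (limn (series (fun l : nat =>
    (bdigit x l (+) bdigit y l)%:R / 2 ^+ l.+1 : R))).

Inductive qmc_kind := Digital | Lattice.

Definition padd (R : realType) (d : nat) (K : qmc_kind) (x y : Rpoint R d) :
    Rpoint R d :=
  [tuple (match K with
          | Digital => digitwise_add (tnth x j : R) (tnth y j : R)
          | Lattice => frac ((tnth x j : R) + (tnth y j : R))
          end : measurableTypeR R) | j < d].

Definition wavenum (K : qmc_kind) (d : nat) : choiceType :=
  match K with
  | Digital => 'rV[nat]_d : choiceType
  | Lattice => 'rV[int]_d : choiceType
  end.

Definition wzero (K : qmc_kind) (d : nat) : wavenum K d :=
  match K return wavenum K d with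
  | Digital => const_mx 0%N
  | Lattice => const_mx 0%Z
  end.

Definition wadd (K : qmc_kind) (d : nat) : wavenum K d -> wavenum K d -> wavenum K d :=
  match K return wavenum K d -> wavenum K d -> wavenum K d with
  | Digital => fun k l => map2_mx Nat.lxor k l
  | Lattice => fun k l => map2_mx (fun a b : int => a + b) k l
  end.

(* <k, x>, normalised to [0, 1).  The bit of weight 2^l of a natural number n
   vanishes for l >= n, whence the range of the inner sum. *)
Definition pairing (R : realType) (d : nat) (K : qmc_kind) :
    wavenum K d -> Rpoint R d -> R :=
  match K return wavenum K d -> Rpoint R d -> R with
  | Digital => fun k x =>
      ((\sum_(j < d) \sum_(l < k ord0 j)
          (Nat.testbit (k ord0 j) l && bdigit (tnth x j : R) l : nat)) %% 2)%N%:R / 2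
  | Lattice => fun k x => frac (\sum_(j < d) (k ord0 j)%:~R * (tnth x j : R))
  end.

(* Base-2 digital sequence with generating matrices C j: the binary digits of
   the j-th coordinate of z_i are C j times the binary digits of i, modulo 2. *)
Definition digital_sequence (R : realType) (d : nat) (z : nat -> Rpoint R d) : Prop :=
  exists C : 'I_d -> nat -> nat -> bool, forall (i : nat) (j : 'I_d),
    0 <= (tnth (z i) j : R) < 1 /\
    forall l : nat, bdigit (tnth (z i) j : R) l =
      odd (\sum_(c < i) (C j l c && Nat.testbit i c : nat)).

Definition van_der_corput (R : realType) (i : nat) : R :=
  \sum_(c < i) (Nat.testbit i c)%:R / 2 ^+ c.+1.

(* Base-2 (extensible) rank-1 lattice node sequence.  The generating vector has
   2-adic integer entries, given by compatible residues g m modulo 2^m; an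
   integer generating vector is the case of constant g. *)
Definition lattice_sequence (R : realType) (d : nat) (z : nat -> Rpoint R d) : Prop :=
  exists g : nat -> 'rV[int]_d,
    (forall m j, (g m.+1 ord0 j = g m ord0 j %[mod 2 ^+ m])%Z) /\
    (forall m i j, (i < 2 ^ m)%N ->
       (tnth (z i) j : R) = frac (van_der_corput R i * (g m ord0 j)%:~R)).

Definition node_sequence (R : realType) (d : nat) (K : qmc_kind)
    (z : nat -> Rpoint R d) : Prop :=
  match K with
  | Digital => digital_sequence z
  | Lattice => lattice_sequence z
  end.

(* Digitwise addition is bilinear for the pairing only where the digitwise sum
   does not end in an infinite string of ones (which would be carried); this
   says that it never does for the shifted nodes.  Nothing is needed for
   addition modulo one. *)
Definition proper_shift (R : realType) (d : nat) (K : qmc_kind)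
    (z : nat -> Rpoint R d) (Delta : Rpoint R d) : Prop :=
  match K with
  | Digital => forall i (j : 'I_d) l,
      bdigit (tnth (padd Digital (z i) Delta) j : R) l =
      bdigit (tnth (z i) j : R) l (+) bdigit (tnth Delta j : R) l
  | Lattice => True
  end.

Definition dual_set (R : realType) (d : nat) (K : qmc_kind) (z : nat -> Rpoint R d)
    (m : nat) : set (wavenum K d) :=
  [set k | forall l, (l < m)%N -> pairing k (z (2 ^ l)%N) = 0].

Definition wavenum_ordering (R : realType) (d : nat) (K : qmc_kind)
    (z : nat -> Rpoint R d) (kt : nat -> wavenum K d) : Prop :=
  [/\ bijective kt, kt 0%N = wzero K d &
      forall m kappa, (kappa < 2 ^ m)%N ->
        [set kt (kappa + lambda * 2 ^ m)%N | lambda in [set: nat]] =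
        [set wadd (kt kappa) k | k in @dual_set R d K z m]].

(* e^(2 pi i t) *)
Definition cis (R : realType) (t : R) : R[i] :=
  cos (2 * pi * t) +i* sin (2 * pi * t).

Definition fourier (R : realType) (d : nat) (K : qmc_kind)
    (f : Rpoint R d -> R) (k : wavenum K d) : R[i] :=
  cube_cint (fun x => (f x)%:C * cis (- pairing k x)).

Definition cabs (R : realType) (c : R[i]) : R := Normc.normc c.

(* The Fourier series is summed over the finite sets of wavenumbers directed by
   inclusion, so that no ordering enters. *)
Definition abs_conv_fourier (R : realType) (d : nat) (K : qmc_kind)
    (f : Rpoint R d -> R) : Prop :=
  (\esum_(k in [set: wavenum K d]) (cabs (fourier f k))%:E < +oo)%E /\
  forall x, @cube R d x ->
    cabs (partial_sum (fun k : wavenum K d => fourier f k * cis (pairing k x)) A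
          - (f x)%:C) @[A --> totally] --> (0 : R).

Section cone.
Context (R : realType) (d : nat) (K : qmc_kind).
Variables (z : nat -> Rpoint R d) (Delta : Rpoint R d) (kt : nat -> wavenum K d).
Variables (lstar r : nat) (homega romega : nat -> R).
Implicit Types f : Rpoint R d -> R.

Definition site (i : nat) : Rpoint R d := padd K (z i) Delta.

Definition dfourier f (m : nat) (k : wavenum K d) : R[i] :=
  (2 ^+ m)^-1 *
  \sum_(0 <= i < 2 ^ m) (f (site i))%:C * cis (- pairing k (site i)).

(* (2 ^ m)./2 is the integer part of 2^(m-1), also for m = 0. *)
Definition Ssum f (m : nat) : R :=
  \sum_((2 ^ m)./2 <= kappa < 2 ^ m) cabs (fourier f (kt kappa)).

Definition Shat f (l m : nat) : \bar R :=
  (\sum_((2 ^ l)./2 <= kappa < 2 ^ l)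
     \sum_(1 <= lambda <oo) (cabs (fourier f (kt (kappa + lambda * 2 ^ m)%N)))%:E)%E.

Definition Scheck f (m : nat) : \bar R :=
  (\sum_((2 ^ m)%N <= kappa <oo) (cabs (fourier f (kt kappa)))%:E)%E.

Definition Stilde f (l m : nat) : R :=
  \sum_((2 ^ l)./2 <= kappa < 2 ^ l) cabs (dfourier f m (kt kappa)).

Definition cone f : Prop :=
  [/\ abs_conv_fourier K f,
      forall l m, (l <= m)%N ->
        (Shat f l m <= (homega (m - l)%N)%:E * Scheck f m)%E &
      forall l m, (lstar <= l)%N -> (l <= m)%N ->
        (Scheck f m <= (romega (m - l)%N * Ssum f l)%:E)%E].

Definition sample_mean f (m : nat) : R :=
  (2 ^+ m)^-1 * \sum_(0 <= i < 2 ^ m) f (site i).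

Definition data_err f (m : nat) : R :=
  homega m * romega r / (1 - homega r * romega r) * Stilde f (m - r) m.

End cone.
Arguments site {R d} K z Delta i.
Arguments sample_mean {R d} K z Delta f m.
Arguments dfourier {R d} K z Delta f m k.
Arguments Stilde {R d} K z Delta kt f l m.
Arguments data_err {R d} K z Delta kt r homega romega f m.
Arguments Ssum {R d} K kt f m.
Arguments Shat {R d} K kt f l m.
Arguments Scheck {R d} K kt f m.
Arguments cone {R d} K kt lstar homega romega f.

Definition err_box (R : realType) (p : nat) (c e : 'rV[R]_p) : set 'rV[R]_p :=
  [set u | forall j, c ord0 j - e ord0 j <= u ord0 j <= c ord0 j + e ord0 j].

Section tolerance.
Context (R : realType) (ea er : R).

Definition tol_den (w : R) : R := Num.max (ea ^+ 2) (er ^+ 2 * `|w| ^+ 2).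

(* The denominator vanishes when ea = 0 and w = 0.  With the inverse of \bar R,
   the value is then +oo if w != w', and 0 if w = w' (an exact answer meets
   every tolerance). *)
Definition tol (w w' : R) : \bar R := (((w - w') ^+ 2)%:E / (tol_den w)%:E)%E.

Definition tol_max (w : R) : R := Num.max ea (er * `|w|).

Definition vhat (vm vp : R) : R :=
  (vm * tol_max vp + vp * tol_max vm) / (tol_max vp + tol_max vm).

Definition tol_opt (vm vp : R) : \bar R :=
  (((vp - vm) ^+ 2)%:E / ((tol_max vp + tol_max vm) ^+ 2)%:E)%E.

(* "tol(w, vhat) = c" for an endpoint w of [vm, vp].  If tol_den w = 0, the
   quotient tol(w, vhat) has the form 0/0, and the equality is read as that of
   the limit of tol(w', vhat) for w' in [vm, vp] tending to w, w' != w. *)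
Definition tol_at_endpoint (vm vp w : R) (c : \bar R) : Prop :=
  if tol_den w != 0 then tol w (vhat vm vp) = c
  else tol w' (vhat vm vp) @[w' --> within `[vm, vp]%classic w^'] --> c.

End tolerance.

(* m is the value at which a loop starting from m0 and incrementing by one until
   crit holds comes to an end. *)
Definition stops_at (crit : nat -> Prop) (m0 m : nat) : Prop :=
  [/\ (m0 <= m)%N, crit m & forall m', (m0 <= m')%N -> (m' < m)%N -> ~ crit m'].

(* Main.v *)
(* For wavenumbers k and k' = k + h, the mean over the nodes of
   e^(2 pi i <h, z_i>) is a product of the factors
   (1 + e^(2 pi i <h, z_(2^l)>)) / 2, which vanishes unless h lies in the dual
   set K_m.  Summing the absolutely convergent Fourier series at the sites, each
   discrete coefficient differs from the true one by at most
   sum_(lambda >= 1) |fhat_(kappa + lambda 2^m)|, and the two cone conditions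
   turn this into |mu - muhat| <= err; hence mu lies in the box B_n.

   For optimality, let M w = max (ea, er |w|) and
   rho = (v+ - v-) / (M v+ + M v-).  For any candidate u the triangle inequality
   |v+ - u| + |u - v-| >= v+ - v- forces |w - u| >= rho M w at one of the
   endpoints w, while for u = vhat the bound |w - vhat| <= rho M w holds
   throughout [v-, v+] because M is Lipschitz with constant er and dominates
   er |w|; it is an equality at both endpoints. *)

Require Import Defs.
From Stdlib Require Import PeanoNat.
From mathcomp Require Import all_boot all_order all_algebra archimedean finmap.
From mathcomp Require Import complex.
From mathcomp Require Import all_classical all_reals all_analysis.
From mathcomp Require Import summability ring lra zify.

Set Implicit Arguments.
Unset Strict Implicit.
Unset Printing Implicit Defensive.

Import Order.TTheory GRing.Theory Num.Theory.
Import numFieldNormedType.Exports.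

Local Open Scope classical_set_scope.
Local Open Scope ring_scope.

(** * Optimality of the approximation *)

Section tolerance_optimum.
Context (R : realType) (ea er : R).
Hypotheses (ea0 : 0 <= ea) (er0 : 0 <= er).
Implicit Types w u c vm vp : R.

Local Notation M := (tol_max ea er).

Lemma tol_max_ge0 w : 0 <= M w.
Proof. by rewrite /tol_max le_max ea0. Qed.

Lemma tol_max_ge w : er * `|w| <= M w.
Proof. by rewrite /tol_max le_max lexx orbT. Qed.

(** Taking the maximum with a constant preserves the Lipschitz constant [er] of [er |w|]. This
    compares the tolerated errors at different values. *)
Lemma tol_max_lip w u : M w <= M u + er * `|w - u|.
Proof.
have e : 0 <= er * `|w - u| by rewrite mulr_ge0.
rewrite {1}/tol_max ge_max; apply/andP; split.
  by rewrite (@le_trans _ _ (M u)) ?lerDl// /tol_max le_max lexx.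
rewrite (le_trans _ (lerD (tol_max_ge u) (lexx _)))// -mulrDr ler_wpM2l//.
by rewrite -{1}(subrK u w) addrC ler_normD.
Qed.

Lemma tol_denE w : tol_den ea er w = M w ^+ 2.
Proof.
rewrite /tol_den /tol_max -exprMn.
have e : 0 <= er * `|w| by rewrite mulr_ge0.
case: (leP ea (er * `|w|)) => h.
  by rewrite (max_idPr _)// ler_sqr ?nnegrE.
by rewrite (max_idPl _)// ler_sqr ?nnegrE// ltW.
Qed.

Lemma tolE w u : M w != 0 -> tol ea er w u = (((w - u) / M w) ^+ 2)%:E.
Proof.
by move=> M0; rewrite /tol tol_denE inver sqrf_eq0 (negbTE M0) -EFinM expr_div_n.
Qed.

(** This reduces tolerance bounds to linear inequalities, including the case [M w = 0]: there [tol]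
    is 0 or [+oo] according to whether [w = u], just as [|w - u| <= 0] holds or fails. *)
Lemma tol_le w u c : 0 <= c ->
  ((tol ea er w u <= (c ^+ 2)%:E)%E <-> `|w - u| <= c * M w).
Proof.
move=> c0; have [M0|M0] := eqVneq (M w) 0; last first.
  have Mp : 0 < M w by rewrite lt0r M0 tol_max_ge0.
  rewrite tolE// lee_fin -(ler_pdivrMr _ `|w - u|)//.
  have -> : `|w - u| / M w = `|(w - u) / M w| by rewrite normf_div (gtr0_norm Mp).
  by rewrite -[X in X <= _](real_normK (num_real _)) ler_sqr ?nnegrE.
rewrite /tol tol_denE M0 expr0n/= mulr0 inver eqxx normr_le0.
have [->|wu] := eqVneq w u; first by rewrite subrr expr0n/= mul0e lee_fin sqr_ge0.
rewrite subr_eq0 (negbTE wu) gt0_muley ?leye_eq//.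
by rewrite lte_fin exprn_even_gt0//= subr_eq0.
Qed.

Lemma tol_ge0 w u : (0 <= tol ea er w u)%E.
Proof.
by rewrite /tol mule_ge0 ?inve_ge0 ?lee_fin ?tol_denE ?sqr_ge0.
Qed.

(** Under [eaer] and [vm <= vp], this is the square root of [tol_opt]. If the denominator vanishes,
    both endpoints are 0 and division by zero in [R] gives the right value 0. *)
Definition opt_ratio vm vp := (vp - vm) / (M vp + M vm).

Local Notation rho := opt_ratio.

Lemma opt_ratio_ge0 vm vp : vm <= vp -> 0 <= rho vm vp.
Proof. by move=> h; rewrite divr_ge0 ?subr_ge0 ?addr_ge0 ?tol_max_ge0. Qed.

Section nondegenerate.
Hypothesis eaer : (ea, er) != (0, 0).

Lemma tol_max_eq0 w : M w = 0 -> [/\ ea = 0, w = 0 & er != 0].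
Proof.
move=> M0; have ea_eq : ea = 0.
  by apply/eqP; rewrite eq_le ea0 -M0 /tol_max le_max lexx.
have er_neq : er != 0 by move: eaer; rewrite xpair_eqE ea_eq eqxx.
split=> //; apply/eqP; rewrite -normr_eq0 eq_le normr_ge0 andbT.
have := tol_max_ge w; rewrite M0 pmulr_rle0//.
by rewrite lt0r er_neq.
Qed.

Lemma tol_maxD_eq0 vm vp : M vp + M vm = 0 -> vm = 0 /\ vp = 0.
Proof.
move/eqP; rewrite paddr_eq0 ?tol_max_ge0// => /andP[/eqP+ /eqP].
by move=> /tol_max_eq0[_ -> _] /tol_max_eq0[_ ->].
Qed.

Lemma opt_ratioM vm vp : rho vm vp * (M vp + M vm) = vp - vm.
Proof.
have [h|h] := eqVneq (M vp + M vm) 0; last by rewrite /rho divfK.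
by have [-> ->] := tol_maxD_eq0 h; rewrite /rho subrr mul0r mul0r.
Qed.

Lemma tol_optE vm vp : tol_opt ea er vm vp = (rho vm vp ^+ 2)%:E.
Proof.
rewrite /tol_opt inver sqrf_eq0; case: eqP => [h|h]; last first.
  by rewrite -EFinM expr_div_n.
have [-> ->] := tol_maxD_eq0 h.
by rewrite /rho subrr expr0n/= mul0e mul0r expr0n.
Qed.

(* Cross-multiplied, the upper half of the bound reads
   (w - vm) (M vp - M w) <= (vp - w) (M w + M vm): the left side is at most
   (w - vm) er (vp - w), and er (w - vm) <= M w + M vm. *)
Lemma vhat_dist vm vp w : vm <= w <= vp ->
  `|w - vhat ea er vm vp| <= rho vm vp * M w.
Proof.
move=> /andP[mw wp]; have [D0|D0] := eqVneq (M vp + M vm) 0.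
  have [vm0 vp0] := tol_maxD_eq0 D0; rewrite vm0 in mw; rewrite vp0 in wp.
  have -> : w = 0 by apply/eqP; rewrite eq_le mw wp.
  by rewrite /vhat /rho D0 invr0 !mulr0 mul0r subr0 normr0.
have Dp : 0 < M vp + M vm by rewrite lt0r D0 addr_ge0 ?tol_max_ge0.
have sum_ge x y : x <= y -> er * (y - x) <= M y + M x.
  move=> xy; apply: le_trans (lerD (tol_max_ge y) (tol_max_ge x)).
  rewrite -mulrDr ler_wpM2l//; have := ler_norm y; have := ler_norm (- x).
  by rewrite normrN; lra.
rewrite /rho mulrAC ler_pdivlMr// -(ger0_norm (ltW Dp)) -normrM mulrBl.
rewrite [vhat _ _ _ _ * _]divfK//.
rewrite ler_norml; apply/andP; split.
- have h1 := tol_max_lip vm w; have h2 := sum_ge _ _ wp.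
  rewrite distrC ger0_norm ?subr_ge0// in h1.
  have h3 : 0 <= (vp - w) * (M w + er * (w - vm) - M vm) by apply: mulr_ge0; lra.
  have h4 : 0 <= (w - vm) * (M vp + M w - er * (vp - w)) by apply: mulr_ge0; lra.
  nra.
- have h1 := tol_max_lip vp w; have h2 := sum_ge _ _ mw.
  rewrite ger0_norm ?subr_ge0// in h1.
  have h3 : 0 <= (w - vm) * (M w + er * (vp - w) - M vp) by apply: mulr_ge0; lra.
  have h4 : 0 <= (vp - w) * (M w + M vm - er * (w - vm)) by apply: mulr_ge0; lra.
  nra.
Qed.

(** The weighted mean [vhat] divides the interval in the ratio [M vm : M vp], so its distance to
    each endpoint is proportional to the error tolerated there. *)
Lemma vhat_distp vm vp : vp - vhat ea er vm vp = rho vm vp * M vp.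
Proof.
have [D0|D0] := eqVneq (M vp + M vm) 0; last by rewrite /vhat /rho; field.
by have [_ vp0] := tol_maxD_eq0 D0; rewrite /vhat /rho D0 invr0 !mulr0 mul0r subr0.
Qed.

Lemma vhat_distm vm vp : vm - vhat ea er vm vp = - (rho vm vp * M vm).
Proof.
have [D0|D0] := eqVneq (M vp + M vm) 0; last by rewrite /vhat /rho; field.
by have [vm0 _] := tol_maxD_eq0 D0; rewrite /vhat /rho D0 invr0 !mulr0 mul0r subr0 oppr0.
Qed.

(** A vanishing [M w] forces [ea = 0] and [w = 0]. Hence [M y = er |y|], and with [y] the other
    endpoint the ratio is [|y| / (er |y|)]. *)
Lemma opt_ratio_attained vm vp w : vm < vp -> M w = 0 -> w = vm \/ w = vp ->
  rho vm vp * er = 1.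
Proof.
move=> mp /[dup] Mw /tol_max_eq0[ea_eq w0 er_neq].
have Ms y : M y = er * `|y|.
  by rewrite /tol_max ea_eq; apply/max_idPr; rewrite mulr_ge0.
rewrite /rho !Ms; case=> wE; rewrite -wE w0 normr0 mulr0 ?add0r ?addr0.
- by rewrite -wE w0 in mp; rewrite gtr0_norm// ?subr0; field; rewrite er_neq gt_eqF.
- by rewrite -wE w0 in mp; rewrite ltr0_norm//; field; rewrite er_neq lt_eqF.
Qed.

Lemma tol_at_endpoint_opt vm vp w : vm <= vp -> w = vm \/ w = vp ->
  tol_at_endpoint ea er vm vp w (tol_opt ea er vm vp).
Proof.
move=> mp wE; rewrite /tol_at_endpoint tol_denE sqrf_eq0; case: ifPn => Mw.
  rewrite tolE// tol_optE; case: wE Mw => -> Mw; last by rewrite vhat_distp mulfK.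
  by rewrite vhat_distm mulNr sqrrN mulfK.
move/negPn/eqP in Mw; have [ea_eq w0 er_neq] := tol_max_eq0 Mw.
have vh0 : vhat ea er vm vp = 0.
  apply/eqP; rewrite -oppr_eq0 -[X in X == _]add0r -[X in X - _]w0.
  case: wE => wE; rewrite wE in Mw *; first by rewrite vhat_distm Mw mulr0 oppr0.
  by rewrite vhat_distp Mw mulr0.
(* In the interval and away from [w] the tolerance is constant: since [vhat] is 0, it equals
   [x^2 / (er x)^2], which does not depend on [x]. *)
apply: cvg_near_cst.
rewrite near_withinE; near=> x => /=; rewrite in_itv/= => /andP[mx xp].
have xw : x != w by near: x; exact: nbhs_dnbhs_neq.
(* If [vm = vp], the interval contains no [x != w] and the limit is vacuous. *)
have lt_mp : vm < vp.
  rewrite lt_neqAle mp andbT; apply: contra xw => /eqP e; rewrite -e in xp wE.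
  have -> : x = vm by apply/eqP; rewrite eq_le mx xp.
  by case: wE => ->.
have x0 : x != 0 by rewrite -w0.
have Mx : M x != 0 by apply: contra x0 => /eqP/tol_max_eq0[_ ->].
have ME : M x = er * `|x|.
  by rewrite /tol_max ea_eq; apply/max_idPr; rewrite mulr_ge0.
have rE := opt_ratio_attained lt_mp Mw wE.
rewrite tolE// tol_optE vh0 subr0 ME; congr (_%:E).
rewrite -[rho vm vp](mulfK er_neq) rE !expr_div_n exprMn real_normK ?num_real//.
by rewrite expr1n; field; rewrite er_neq x0.
Unshelve. all: by end_near. Qed.

Section value_set.
Variable V : set R.
Hypotheses (V0 : V !=set0) (lV : has_lbound V) (uV : has_ubound V).

Let vm := inf V.
Let vp := sup V.

Lemma inf_le_value w : V w -> vm <= w <= vp.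
Proof. by move=> Vw; rewrite ge_inf//= ub_le_sup. Qed.

Lemma inf_le_sup_value : vm <= vp.
Proof. by case: V0 => w /inf_le_value/andP[]; exact: le_trans. Qed.

(* No [c] smaller than [opt_ratio vm vp] can work: the distances of [u] to values
   close to [vm] and to [vp] add up to nearly [vp - vm]. *)
Lemma opt_ratio_le u c : 0 <= c -> (forall w, V w -> `|w - u| <= c * M w) ->
  rho vm vp <= c.
Proof.
move=> c0 uc; have [D0|D0] := eqVneq (M vp + M vm) 0.
  by rewrite /rho D0 invr0 mulr0.
have Dp : 0 < M vp + M vm by rewrite lt0r D0 addr_ge0 ?tol_max_ge0.
rewrite -(ler_pM2r Dp) opt_ratioM; apply/ler_addgt0Pl => e e0.
(* Replacing each extreme by a value within [t] of it costs [t] in distance and [c * er * t] in the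
   bound; both ends together cost [t * b = e]. *)
pose b := 2 * (1 + c * er); pose t := e / b.
have b0 : 0 < b by rewrite /b mulr_gt0// ltr_wpDr// mulr_ge0.
have t0 : 0 < t by rewrite divr_gt0.
have [w1 Vw1 w1m] : exists2 w, V w & w < vm + t by apply: inf_adherent.
have [w2 Vw2 w2p] : exists2 w, V w & vp - t < w by apply: sup_adherent.
have /andP[mw1 _] := inf_le_value Vw1; have /andP[_ w2v] := inf_le_value Vw2.
have h1 := uc _ Vw1; have h2 := uc _ Vw2.
have M1 : M w1 <= M vm + er * t.
  apply: le_trans (tol_max_lip _ vm) _; rewrite lerD2l ler_wpM2l// ger0_norm; lra.
have M2 : M w2 <= M vp + er * t.
  apply: le_trans (tol_max_lip _ vp) _; rewrite lerD2l ler_wpM2l// ler0_norm; lra.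
have k1 := ler_wpM2l c0 M1; have k2 := ler_wpM2l c0 M2.
have n1 := ler_norm (u - w1); rewrite distrC in n1.
have n2 := ler_norm (w2 - u).
have eE : e = t * b by rewrite /t divfK// gt_eqF.
by rewrite eE /b; lra.
Qed.

(** An infinite supremum is trivial. A finite supremum [s] bounds every distance by [sqrt s * M w],
    so [opt_ratio_le] applies with [c = sqrt s]. *)
Lemma tol_opt_le_sup u :
  (tol_opt ea er vm vp <= ereal_sup [set tol ea er w u | w in V])%E.
Proof.
set S := ereal_sup _; have tS w : V w -> (tol ea er w u <= S)%E.
  by move=> Vw; apply: ereal_sup_ubound => /=; exists w.
have S0 : (0 <= S)%E by case: V0 => w /tS; apply: le_trans; exact: tol_ge0.
case: S tS S0 => [s| |] tS S0; rewrite ?leey//.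
rewrite lee_fin in S0; rewrite tol_optE lee_fin -(sqr_sqrtr S0).
rewrite ler_sqr ?nnegrE ?sqrtr_ge0 ?opt_ratio_ge0 ?inf_le_sup_value//.
apply: (opt_ratio_le (u := u)); first exact: sqrtr_ge0.
by move=> w Vw; apply/tol_le; rewrite ?sqrtr_ge0// sqr_sqrtr// tS.
Qed.

End value_set.

Lemma tol_vhat_le vm vp w : vm <= w <= vp ->
  (tol ea er w (vhat ea er vm vp) <= tol_opt ea er vm vp)%E.
Proof.
move=> wv; rewrite tol_optE; apply/tol_le; last exact: vhat_dist.
by case/andP: wv => mw wp; rewrite opt_ratio_ge0// (le_trans mw).
Qed.

(** The lower bound needs only the values in [V], while the upper bound, reached by [vhat], holds on
    the whole interval. The same squeeze thus serves every set between [V] and the interval, in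
    particular these two. *)
Lemma tol_optimum (V : set R) (vm := inf V) (vp := sup V) :
  V !=set0 -> has_lbound V -> has_ubound V ->
  [/\ ereal_inf [set ereal_sup [set tol ea er w u | w in V] | u in [set: R]] =
        tol_opt ea er vm vp,
      ereal_inf [set ereal_sup [set tol ea er w u | w in `[vm, vp]] | u in [set: R]] =
        tol_opt ea er vm vp &
      ereal_sup [set tol ea er w (vhat ea er vm vp) | w in `[vm, vp]] =
        tol_opt ea er vm vp].
Proof.
move=> V0 lV uV.
have VI : V `<=` `[vm, vp] by move=> w Vw /=; rewrite in_itv/= inf_le_value.
have lower W u : V `<=` W ->
    (tol_opt ea er vm vp <= ereal_sup [set tol ea er w u | w in W])%E.
  move=> VW; apply: le_trans (tol_opt_le_sup V0 lV uV u) _.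
  by apply: ereal_sup_le; exact: image_subset.
have upper W : W `<=` `[vm, vp] ->
    (ereal_sup [set tol ea er w (vhat ea er vm vp) | w in W] <=
     tol_opt ea er vm vp)%E.
  move=> WI; apply: ge_ereal_sup => _ [w Ww <-]; have := WI _ Ww; rewrite /= in_itv/=.
  exact: tol_vhat_le.
have inf_eq W : V `<=` W -> W `<=` `[vm, vp] ->
    ereal_inf [set ereal_sup [set tol ea er w u | w in W] | u in [set: R]] =
    tol_opt ea er vm vp.
  move=> VW WI; apply/eqP; rewrite eq_le; apply/andP; split.
    apply: le_trans (upper _ WI); apply: ereal_inf_lbound.
    by exists (vhat ea er vm vp).
  by apply: le_ereal_inf_tmp => _ [u _ <-]; exact: lower.
split; [exact: inf_eq|exact: inf_eq|].
by apply/eqP; rewrite eq_le upper//= lower.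
Qed.

End nondegenerate.
End tolerance_optimum.

(** * Characters of the binary digits and of the nodes *)

Section binary_digits.

Lemma testbitE i c : Nat.testbit i c = odd (i %/ 2 ^ c).
Proof.
have oddE j : Nat.odd j = odd j.
  by elim/ltn_ind: j => -[|[|j]] //= IH; rewrite negbK -IH ?leqnSn.
have halfE j : Nat.div2 j = j./2.
  by elim/ltn_ind: j => -[|[|j]] //= IH; rewrite -IH ?leqnSn.
elim: c i => [|c IHc] i; first by rewrite divn1 /= oddE.
by rewrite expnS divnMA divn2 -halfE -IHc.
Qed.

Lemma testbit_small i c : (i < 2 ^ c)%N -> Nat.testbit i c = false.
Proof. by move=> h; rewrite testbitE divn_small. Qed.

(** No carry occurs, because all bits of [i] lie below position [l]. *)
Lemma testbit_addpow i l c : (i < 2 ^ l)%N ->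
  Nat.testbit (i + 2 ^ l) c = (c == l) || Nat.testbit i c.
Proof.
move=> il; case: (ltngtP c l) => cl /=; last 1 first.
- by rewrite cl testbitE divnDr// divnn expn_gt0 divn_small.
- rewrite !testbitE -(subnK (ltnW cl)) expnD addnC divnMDl ?expn_gt0//.
  by rewrite oddD oddX subn_eq0 leqNgt cl.
- have il' : (i < 2 ^ c)%N by rewrite (leq_trans il)// leq_exp2l// ltnW.
  rewrite !testbit_small//.
  by apply: leq_trans (_ : 2 ^ l.+1 <= _)%N; rewrite ?leq_exp2l// expnS mul2n -addnn ltn_add2r.
Qed.

Lemma testbit_lxor a b c :
  Nat.testbit (Nat.lxor a b) c = Nat.testbit a c (+) Nat.testbit b c.
Proof. by rewrite Nat.lxor_spec; case: (Nat.testbit a c); case: (Nat.testbit b c). Qed.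

(** Common form of the digits of digital nodes (before reduction modulo 2) and of the van der Corput
    sequence. The range [c < i] covers all bits of [i], since [i < 2 ^ i]. *)
Definition bitsum (V : nmodType) (G : nat -> V) (i : nat) : V :=
  \sum_(c < i) (if Nat.testbit i c then G c else 0).

Lemma bitsumE (V : nmodType) (G : nat -> V) i n : (i <= n)%N ->
  bitsum G i = \sum_(c < n) (if Nat.testbit i c then G c else 0).
Proof.
move=> le_in; rewrite /bitsum.
rewrite (big_ord_widen n (fun c => if Nat.testbit i c then G c else 0))// big_mkcond/=.
apply: eq_bigr => c _; case: ltnP => // ic.
by rewrite testbit_small// (leq_ltn_trans ic)// ltn_expl.
Qed.

Lemma bitsum_addpow (V : nmodType) (G : nat -> V) i l : (i < 2 ^ l)%N ->
  bitsum G (i + 2 ^ l) = bitsum G i + G l.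
Proof.
move=> il; rewrite !(@bitsumE _ G _ (i + 2 ^ l)) ?leq_addr//.
have lN : (l < i + 2 ^ l)%N by rewrite (leq_trans (ltn_expl l (isT : 1 < 2)%N))// leq_addl.
rewrite [in LHS](bigD1 (Ordinal lN))//= [in RHS](bigD1 (Ordinal lN))//=.
rewrite testbit_addpow// eqxx testbit_small// add0r addrC; congr (_ + _).
apply: eq_bigr => c; rewrite -val_eqE/= => cl.
by rewrite testbit_addpow// (negbTE cl).
Qed.

Lemma bitsum_pow (V : nmodType) (G : nat -> V) l : bitsum G (2 ^ l) = G l.
Proof.
by rewrite -[(2 ^ l)%N]add0n bitsum_addpow ?expn_gt0// /bitsum big_ord0 add0r.
Qed.

End binary_digits.

(** * Character sums over blocks of length a power of two *)

Section characters_of_the_binary_group.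

(** The indices from [2 ^ m] to [2 ^ m.+1] contribute [chi (2 ^ m)] times the sum over the first
    block. Multiplicativity is asked only for adding a new leading bit, which digital and lattice
    nodes both satisfy. *)
Lemma sum_bit_character (C : comNzRingType) (chi : nat -> C) m :
  chi 0%N = 1 ->
  (forall i l, (i < 2 ^ l)%N -> chi (i + 2 ^ l)%N = chi i * chi (2 ^ l)%N) ->
  \sum_(0 <= i < 2 ^ m) chi i = \prod_(l < m) (1 + chi (2 ^ l)%N).
Proof.
move=> chi0 chiD; elim: m => [|m IHm]; first by rewrite big_nat1 big_ord0.
rewrite big_ord_recr/= -IHm expnS mul2n -addnn.
rewrite (@big_cat_nat _ _ _ (2 ^ m)%N)//= ?leq_addr// mulrDr mulr1; congr (_ + _).
rewrite -{1}[(2 ^ m)%N]add0n big_addn addnK mulr_suml.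
by apply: eq_big_nat => i /andP[_ im]; rewrite chiD.
Qed.

(* The sum is the product of the [1 + chi (2 ^ l)], so no [chi (2 ^ l)] is [-1];
   as each is a square root of 1 or of its predecessor, they are all 1. *)
Lemma bit_character_trivial (C : idomainType) (chi : nat -> C) m :
  chi 0%N = 1 ->
  (forall i l, (i < 2 ^ l)%N -> chi (i + 2 ^ l)%N = chi i * chi (2 ^ l)%N) ->
  chi 1%N ^+ 2 = 1 ->
  (forall l, chi (2 ^ l.+1)%N ^+ 2 = 1 \/ chi (2 ^ l.+1)%N ^+ 2 = chi (2 ^ l)%N) ->
  \sum_(0 <= i < 2 ^ m) chi i != 0 ->
  forall l, (l < m)%N -> chi (2 ^ l)%N = 1.
Proof.
move=> chi0 chiD chi1 chiS; rewrite sum_bit_character// => /prodf_neq0 nz.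
have sqr1 l : (l < m)%N -> chi (2 ^ l)%N ^+ 2 = 1 -> chi (2 ^ l)%N = 1.
  move=> lm /eqP; rewrite sqrf_eq1 => /orP[/eqP//|/eqP e].
  by have := nz (Ordinal lm) isT; rewrite /= e subrr eqxx.
elim=> [|l IHl] lm; first exact: sqr1.
by apply: sqr1 => //; case: (chiS l) => ->//; exact/IHl/ltnW.
Qed.

End characters_of_the_binary_group.

(** * The exponential [cis] and its periodicity *)

Section cis_theory.
Local Open Scope complex_scope.
Variable R : realType.
Implicit Types s t : R.
Local Notation cis := (@cis R).

Lemma cisD s t : cis (s + t) = cis s * cis t.
Proof.
rewrite /cis mulrDr cosD sinD; apply/eqP; rewrite eq_complex /=.
by rewrite eqxx /= addrC.
Qed.

Lemma cis0 : cis 0 = 1.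
Proof. by rewrite /cis mulr0 cos0 sin0. Qed.

Lemma cisN t : cis t * cis (- t) = 1.
Proof. by rewrite -cisD subrr cis0. Qed.

Lemma cis_neq0 t : cis t != 0.
Proof.
by apply/eqP => t0; have := cisN t; rewrite t0 mul0r => /esym/eqP; rewrite oner_eq0.
Qed.

Lemma cabs_cis t : cabs (cis t) = 1.
Proof. by rewrite /cabs /Normc.normc /cis cos2Dsin2 sqrtr1. Qed.

Lemma cis_nat n : cis n%:R = 1.
Proof.
elim: n => [|n IHn]; first exact: cis0.
rewrite -natr1 cisD IHn mul1r /cis mulr1 mulr_natl cos2pi.
by rewrite mulr2n sinD sinpi !(mul0r, mulr0) addr0.
Qed.

Lemma cis_int (n : int) : cis n%:~R = 1.
Proof.
case: n => n; first exact: cis_nat.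
by have := cisN n.+1%:R; rewrite cis_nat mul1r NegzE mulrNz.
Qed.

Lemma cis_congr s t : s - t \is a Num.int -> cis s = cis t.
Proof. by case/intrP => n e; rewrite -(subrK t s) cisD e cis_int mul1r. Qed.

Lemma cis_half : cis 2^-1 = -1.
Proof.
rewrite /cis mulrAC divff ?pnatr_eq0// mul1r cospi sinpi.
by apply/eqP; rewrite eq_complex /= oppr0 !eqxx.
Qed.

(** By the double angle formula the real part is [1 - 2 sin(pi t)^2], and [sin (pi t)] is positive
    for [0 < t < 1]. *)
Lemma cis_eq1 t : 0 <= t < 1 -> cis t = 1 -> t = 0.
Proof.
move=> /andP[t0 t1] ct; apply/eqP; move: t0; rewrite le_eqVlt eq_sym => /orP[//|t0].
have sp : 0 < sin (pi * t) by rewrite sin_gt0_pi// mulr_gt0 ?pi_gt0//= gtr_pMr// pi_gt0.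
have : cos (2 * pi * t) = 1 by case: ct.
rewrite -mulrA mulr_natl cos_mulr2n => ct1.
have s2 : 0 < sin (pi * t) ^+ 2 by rewrite exprn_gt0.
by have := cos2Dsin2 (pi * t); lra.
Qed.

Lemma frac_bounds t : 0 <= Defs.frac t < 1.
Proof. by rewrite /Defs.frac subr_ge0 floor_le_tmp ltrBlDl -intrD1 floorD1_gt. Qed.

Lemma fracB_int t : Defs.frac t - t \is a Num.int.
Proof. by rewrite /Defs.frac addrC addKr rpredN intr_int. Qed.

Lemma cis_frac t : cis (Defs.frac t) = cis t.
Proof. exact/cis_congr/fracB_int. Qed.

End cis_theory.

(** * Characters of wavenumbers at points, nodes and shifted sites *)

Section wavenumber_characters.
Local Open Scope complex_scope.
Context (R : realType) (d : nat).

Definition echar (K : qmc_kind) (k : wavenum K d) (x : Rpoint R d) : R[i] :=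
  cis (pairing k x).

Section digital.
Implicit Types (k : wavenum Digital d) (x y : Rpoint R d).

Definition digit_product k x : nat :=
  \sum_(j < d) \sum_(l < k ord0 j)
    (Nat.testbit (k ord0 j) l && bdigit (tnth x j : R) l : nat).

Lemma echar_digital k x : echar k x = (-1) ^+ digit_product k x.
Proof.
rewrite /echar /pairing -/(digit_product k x) modn2 -signr_odd.
by case: (odd _); rewrite ?mul0r ?cis0// mul1r cis_half.
Qed.

Lemma sum_addb (I : Type) (r : seq I) (P : pred I) (F G H : I -> nat) :
  (forall i, P i -> odd (F i) = odd (G i) (+) odd (H i)) ->
  odd (\sum_(i <- r | P i) F i) =
  odd (\sum_(i <- r | P i) G i) (+) odd (\sum_(i <- r | P i) H i).
Proof.
move=> FGH; elim/big_ind3: _ => // a b c a' b' c'; rewrite !oddD => -> ->.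
by rewrite addbACA.
Qed.

(** The hypothesis concerns digits rather than [digitwise_add], so that it fits both the nodes and
    the properly shifted sites. *)
Lemma echar_addb k x y y' :
  (forall (j : 'I_d) l, bdigit (tnth x j : R) l =
     bdigit (tnth y j : R) l (+) bdigit (tnth y' j : R) l) ->
  echar k x = echar k y * echar k y'.
Proof.
move=> xyy'; rewrite !echar_digital -exprD -signr_odd -[RHS]signr_odd oddD.
congr (_ ^+ nat_of_bool _); apply: sum_addb => j _; apply: sum_addb => l _.
by rewrite !oddb xyy' andb_addr.
Qed.

(** A common range of bits makes the products of different wavenumbers comparable term by term. *)
Lemma digit_productE k x n : (forall j, k ord0 j <= n)%N ->
  digit_product k x = (\sum_(j < d) \sum_(l < n)
    (Nat.testbit (k ord0 j) l && bdigit (tnth x j : R) l : nat))%N.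
Proof.
move=> kn; apply: eq_bigr => j _.
have bitE N : (\sum_(l < N) (Nat.testbit (k ord0 j) l && bdigit (tnth x j : R) l : nat))%N =
    (\sum_(l < N) if Nat.testbit (k ord0 j) l then bdigit (tnth x j : R) l : nat else 0)%N.
  by apply: eq_bigr => l _; case: Nat.testbit.
by rewrite !bitE -(bitsumE (fun l => bdigit (tnth x j : R) l : nat) (kn j)).
Qed.

Lemma echar_lxor k k' x : echar (wadd k k') x = echar k x * echar k' x.
Proof.
rewrite !echar_digital -exprD -signr_odd -[RHS]signr_odd oddD.
pose n := (\max_j ((wadd k k' : 'rV[nat]_d) ord0 j + k ord0 j + k' ord0 j))%N.
have le_n j : ((wadd k k' : 'rV[nat]_d) ord0 j + k ord0 j + k' ord0 j <= n)%N.
  exact: (leq_bigmax j).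
rewrite !(@digit_productE _ _ n); first last.
- by move=> j; apply: leq_trans (le_n j); rewrite -addnA leq_addr.
- by move=> j; apply: leq_trans (le_n j); rewrite addnAC leq_addl.
- by move=> j; apply: leq_trans (le_n j); rewrite leq_addl.
congr (_ ^+ nat_of_bool _); apply: sum_addb => j _; apply: sum_addb => l _.
by rewrite !oddb mxE testbit_lxor andb_addl.
Qed.

Lemma echar_digital_sqr k x : echar k x ^+ 2 = 1.
Proof. by rewrite echar_digital exprAC sqrrN expr1n expr1n. Qed.

(** The generating matrices act linearly modulo 2, and [i] and [2 ^ l] have disjoint sets of
    bits. *)
Lemma digital_sequenceD (z : nat -> Rpoint R d) i l (j : 'I_d) c :
  digital_sequence z -> (i < 2 ^ l)%N ->
  bdigit (tnth (z (i + 2 ^ l)%N) j : R) c =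
  bdigit (tnth (z i) j : R) c (+) bdigit (tnth (z (2 ^ l)%N) j : R) c.
Proof.
move=> [C zC] il; rewrite !(proj2 (zC _ _)).
have bitE n : (\sum_(a < n) (C j c a && Nat.testbit n a : nat))%N =
    bitsum (fun a => C j c a : nat) n.
  by apply: eq_bigr => a _; case: Nat.testbit; rewrite ?andbT ?andbF.
by rewrite !bitE bitsum_addpow// bitsum_pow oddD.
Qed.

End digital.

Section lattice.
Implicit Types (k : wavenum Lattice d) (x y : Rpoint R d).

Lemma echar_lattice_padd k x y : echar k (padd Lattice x y) = echar k x * echar k y.
Proof.
rewrite /echar /= !cis_frac -cisD; apply: cis_congr.
rewrite -big_split -sumrB /= rpred_sum// => j _.
by rewrite -mulrDr -mulrBr tnth_mktuple rpredM ?intr_int// fracB_int.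
Qed.

Lemma echar_lattice_wadd k k' x : echar (wadd k k') x = echar k x * echar k' x.
Proof.
rewrite /echar /= !cis_frac -cisD -big_split/=; congr cis.
by apply: eq_bigr => j _; rewrite mxE intrD mulrDl.
Qed.

(** [N m] is the inner product of [k] with the generating vector at level [m]; as [k] is integral,
    the [frac] in each coordinate changes the pairing by an integer only. *)
Lemma lattice_sequence_char (z : nat -> Rpoint R d) k : lattice_sequence z ->
  exists N : nat -> int, forall m i, (i < 2 ^ m)%N ->
    echar k (z i) = cis (van_der_corput R i * (N m)%:~R).
Proof.
move=> [g [_ zg]]; exists (fun m => \sum_(j < d) k ord0 j * g m ord0 j) => m i im.
rewrite /echar /= cis_frac; apply: cis_congr.
rewrite (raddf_sum (intr : int -> R)) mulr_sumr -sumrB /= rpred_sum// => j _.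
rewrite (zg m)// intrM [X in _ - X]mulrCA -mulrBr rpredM ?intr_int//.
exact: fracB_int.
Qed.

Lemma van_der_corputE i :
  van_der_corput R i = bitsum (fun c => (2 ^+ c.+1)^-1 : R) i.
Proof.
by apply: eq_bigr => c _; case: Nat.testbit; rewrite ?mul1r ?mul0r.
Qed.

End lattice.

Section both_kinds.
Variable K : qmc_kind.
Implicit Types (k h : wavenum K d) (x : Rpoint R d).

Lemma echar_wadd k h x : echar (wadd k h) x = echar k x * echar h x.
Proof. by case: K k h => k h; [exact: echar_lxor|exact: echar_lattice_wadd]. Qed.

Lemma wadd_surj k k' : exists h, k' = wadd k h.
Proof.
case: K k k' => k k'.
  exists (wadd k k'); apply/rowP => j; rewrite !mxE.
  by rewrite -Nat.lxor_assoc Nat.lxor_nilpotent Nat.lxor_0_l.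
by exists (\row_j (k' ord0 j - k ord0 j)); apply/rowP => j; rewrite !mxE subrKC.
Qed.

Lemma pairing_bounds k x : 0 <= pairing k x < 1.
Proof.
case: K k => k; last exact: frac_bounds.
rewrite /pairing modn2 divr_ge0//= ltr_pdivrMr// mul1r.
by case: odd; rewrite ?ltr0n// ltr1n.
Qed.

Lemma pairing_eq0 k x : echar k x = 1 -> pairing k x = 0.
Proof. exact/cis_eq1/pairing_bounds. Qed.

Lemma pairing_wzero x : pairing (wzero K d) x = 0.
Proof.
rewrite /pairing /wzero; case: K.
  by rewrite big1 ?mod0n ?mul0r// => j _; rewrite mxE big_ord0.
by rewrite big1 ?/Defs.frac ?floor0 ?subrr// => j _; rewrite mxE mul0r.
Qed.

Variable z : nat -> Rpoint R d.
Hypothesis zK : node_sequence K z.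

Lemma echar_node_add k i l : (i < 2 ^ l)%N ->
  echar k (z (i + 2 ^ l)%N) = echar k (z i) * echar k (z (2 ^ l)%N).
Proof.
move=> il; case: K k zK => k zK'.
  by apply: echar_addb => j c; exact: digital_sequenceD.
have [N zN] := lattice_sequence_char k zK'.
(* At level [l.+1] the three indices [i], [2 ^ l] and [i + 2 ^ l] share one integer [N l.+1]. *)
have lt2 : (2 ^ l < 2 ^ l.+1)%N by rewrite ltn_exp2l.
have iln : (i + 2 ^ l < 2 ^ l.+1)%N by rewrite expnS mul2n -addnn ltn_add2r.
rewrite !(zN l.+1)// ?(ltn_trans il)// -cisD -mulrDl !van_der_corputE.
by rewrite bitsum_addpow// bitsum_pow.
Qed.

Lemma echar_node0 k : echar k (z 0%N) = 1.
Proof.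
(* Multiplicativity for [0 + 1] gives the value at [z 0] after cancelling the nonzero value at
   [z 1]. *)
have := @echar_node_add k 0 0 isT; rewrite add0n => /esym e.
by apply: (mulIf (cis_neq0 (pairing k (z (2 ^ 0)%N)))); rewrite mul1r.
Qed.

Lemma echar_node1 k : echar k (z 1%N) ^+ 2 = 1.
Proof.
case: K k zK => k zK'; first exact: echar_digital_sqr.
have [N zN] := lattice_sequence_char k zK'.
rewrite (zN 1%N)// van_der_corputE -[1%N]/(2 ^ 0)%N bitsum_pow expr2 -cisD.
by rewrite -mulrDl (_ : _ + _ = 1 :> R) ?mul1r ?cis_int//; field.
Qed.

(** Digital characters are signs. For lattices the van der Corput value at [2 ^ l.+1] is half the
    one at [2 ^ l], so squaring steps back one level. *)
Lemma echar_nodeS k l : echar k (z (2 ^ l.+1)%N) ^+ 2 = 1 \/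
  echar k (z (2 ^ l.+1)%N) ^+ 2 = echar k (z (2 ^ l)%N).
Proof.
case: K k zK => k zK'; [left; exact: echar_digital_sqr|right].
have [N zN] := lattice_sequence_char k zK'.
rewrite !(zN l.+2)// ?ltn_exp2l// !van_der_corputE !bitsum_pow expr2 -cisD.
rewrite -mulrDl; congr (cis (_ * _)).
by rewrite [2 ^+ l.+2]exprSr invfM mulrC -mulr_natl; field.
Qed.

(** The character is 1 at each [z (2 ^ l)] by [bit_character_trivial]; pairings are normalised to
    [[0, 1)], so they vanish there. *)
Lemma sum_echar_node k m :
  \sum_(0 <= i < 2 ^ m) echar k (z i) != 0 -> dual_set z m k.
Proof.
move=> nz l lm; apply: pairing_eq0.
apply: (bit_character_trivial (chi := fun i => echar k (z i))) nz _ lm => /=.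
- exact: echar_node0.
- exact: echar_node_add.
- exact: echar_node1.
- exact: echar_nodeS.
Qed.

Variable Delta : Rpoint R d.
Hypothesis zDelta : proper_shift K z Delta.

Lemma echar_site k i : echar k (site K z Delta i) = echar k (z i) * echar k Delta.
Proof.
rewrite /site; case: K k zDelta => k zD; last exact: echar_lattice_padd.
exact: echar_addb.
Qed.

(** With [k' = k + h] each summand reduces to the character of [h] at the site, and the shift
    contributes a common factor [echar h Delta]. *)
Lemma sum_echar_site k k' m :
  \sum_(0 <= i < 2 ^ m)
    echar k' (site K z Delta i) * cis (- pairing k (site K z Delta i)) != 0 ->
  exists2 h, dual_set z m h & k' = wadd k h.
Proof.
have [h ->] := wadd_surj k k' => nz; exists h => //.
apply: sum_echar_node; apply: contra nz => /eqP nz.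
rewrite (_ : \sum_(_ <= _ < _) _ = (\sum_(0 <= i < 2 ^ m) echar h (z i)) * echar h Delta).
  by rewrite nz mul0r.
rewrite mulr_suml; apply: eq_bigr => i _.
by rewrite echar_wadd mulrAC [echar k _ * _]cisN mul1r echar_site.
Qed.

Lemma site_cube i : @cube R d (site K z Delta i).
Proof.
rewrite /site /padd => j; rewrite tnth_mktuple.
by case: K => /=; exact: frac_bounds.
Qed.

End both_kinds.
End wavenumber_characters.

(** * Aliasing and the data-based error bound *)

#[local] Arguments cabs {R} c : simpl never.
#[local] Arguments fourier {R d K} f k : simpl never.

Section cabs_theory.
Local Open Scope complex_scope.
Variable R : realType.
Implicit Types a b : R[i].

Lemma cabs_ge0 a : 0 <= cabs a.
Proof. by case: a => x y; rewrite /cabs /Normc.normc sqrtr_ge0. Qed.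

Lemma cabsD a b : cabs (a + b) <= cabs a + cabs b.
Proof. exact: le_normcD. Qed.

Lemma cabsM a b : cabs (a * b) = cabs a * cabs b.
Proof. exact: Normc.normcM. Qed.

Lemma cabsN a : cabs (- a) = cabs a.
Proof. exact: normcN. Qed.

Lemma cabs0 : cabs (0 : R[i]) = 0.
Proof. exact: Normc.normc0. Qed.

Lemma cabs_real (x : R) : cabs x%:C = `|x|.
Proof. by rewrite /cabs /Normc.normc /= expr0n/= addr0 sqrtr_sqr. Qed.

Lemma cabs_sum (I : Type) (r : seq I) (P : pred I) (F : I -> R[i]) :
  cabs (\sum_(i <- r | P i) F i) <= \sum_(i <- r | P i) cabs (F i).
Proof.
elim/big_ind2: _ => [|a x b y ax yb|//]; first by rewrite cabs0.
exact: le_trans (cabsD _ _) (lerD ax yb).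
Qed.

Lemma cabs_pow2V m : cabs (((2 ^+ m)^-1 : R[i])) = (2 ^+ m)^-1.
Proof.
rewrite (_ : _^-1 = ((2 ^+ m)^-1 : R)%:C); last by rewrite fmorphV rmorphXn/= rmorph_nat.
by rewrite cabs_real ger0_norm// invr_ge0 exprn_ge0.
Qed.

End cabs_theory.

Lemma partial_sumE (I : choiceType) (V : zmodType) (x : I -> V) (A : {fset I}) :
  partial_sum x A = \sum_(i <- A) x i.
Proof. by rewrite big_seq_fsetE. Qed.

(** * Aliasing of discrete Fourier coefficients *)

Section aliasing.
Local Open Scope complex_scope.
Context (R : realType) (d : nat) (K : qmc_kind).
Variables (z : nat -> Rpoint R d) (Delta : Rpoint R d).
Implicit Types (f : Rpoint R d -> R) (k : wavenum K d).

Local Notation x_ := (site K z Delta).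

(* The coefficient of [fourier f k'] in the aliasing expansion
   dfourier f m k = \sum_k' fourier f k' * site_corr m k k'. *)
Definition site_corr m k k' : R[i] :=
  (2 ^+ m)^-1 * \sum_(0 <= i < 2 ^ m) echar k' (x_ i) * cis (- pairing k (x_ i)).

Lemma site_corr_diag m k : site_corr m k k = 1.
Proof.
rewrite /site_corr (eq_bigr (fun=> 1)); last by move=> i _; exact: cisN.
by rewrite big_const_nat subn0 iter_addr_0 natrX mulVf// expf_neq0// pnatr_eq0.
Qed.

Lemma cabs_site_corr_le m k k' : cabs (site_corr m k k') <= 1.
Proof.
rewrite /site_corr cabsM cabs_pow2V ler_pdivrMl ?exprn_gt0// mulr1.
apply: le_trans (cabs_sum _ _ _) _.
rewrite (eq_bigr (fun=> 1)); last by move=> i _; rewrite cabsM !cabs_cis mulr1.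
by rewrite big_const_nat subn0 iter_addr_0 natrX.
Qed.

(** For a partial sum of the Fourier series, aliasing is finite algebra. Replacing [f] by a partial
    sum costs [delta A], the mean residual over finitely many sites, which tends to 0. *)
Lemma dfourier_aliasing f m k (S : set (wavenum K d)) : abs_conv_fourier K f ->
  (forall k', k' != k -> site_corr m k k' != 0 -> S k') ->
  ((cabs (dfourier K z Delta f m k - fourier f k))%:E <=
   \esum_(k' in S) (cabs (fourier f k'))%:E)%E.
Proof.
move=> [_ fE] kS; set Y := esum _ _.
have Y0 : (0 <= Y)%E by apply: esum_ge0 => k' _; rewrite lee_fin cabs_ge0.
pose g k' := fourier f k'.
pose res i (A : {fset wavenum K d}) : R :=
  cabs (partial_sum (fun k' => g k' * cis (pairing k' (x_ i))) A - (f (x_ i))%:C).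
pose delta A := (2 ^+ m)^-1 * \sum_(0 <= i < 2 ^ m) res i A.
have FF : ProperFilter (@totally (wavenum K d)) by exact: totally_filter.
have delta0 : delta A @[A --> totally] --> (0 : R).
  rewrite -(mulr0 (2 ^+ m)^-1); apply: cvgM; first exact: cvg_cst.
  rewrite [X in _ --> X](_ : _ = \sum_(0 <= i < 2 ^ m) (0 : R)); last by rewrite big1.
  apply: (cvg_big (op := +%R)) => [|i _]; last by apply: fE; exact: site_cube.
  exact: add_continuous.
have main A : k \in A -> ((cabs (dfourier K z Delta f m k - g k))%:E <= (delta A)%:E + Y)%E.
  (* [P] is the discrete coefficient of the partial sum over [A]. Since [k] is in [A], it contains
     the diagonal term [g k]. *)
  move=> kA; pose P := \sum_(k' <- A) g k' * site_corr m k k'.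
  have PE : P - dfourier K z Delta f m k = (2 ^+ m)^-1 * \sum_(0 <= i < 2 ^ m)
      (partial_sum (fun k' => g k' * cis (pairing k' (x_ i))) A - (f (x_ i))%:C) *
        cis (- pairing k (x_ i)).
    rewrite /dfourier [in RHS](eq_bigr _ (fun i _ => mulrBl _ _ _)) sumrB mulrBr.
    congr (_ - _); rewrite /P (eq_bigr _ (fun k' _ => mulrCA (g k') _ _)) -mulr_sumr.
    congr (_ * _); under eq_bigr do rewrite mulr_sumr.
    rewrite exchange_big /=; apply: eq_bigr => i _.
    rewrite partial_sumE mulr_suml.
    by apply: eq_bigr => k' _; rewrite mulrA.
  have deltaP : cabs (P - dfourier K z Delta f m k) <= delta A.
    rewrite PE cabsM cabs_pow2V ler_pM2l ?invr_gt0 ?exprn_gt0//.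
    apply: le_trans (cabs_sum _ _ _) _.
    by apply: ler_sum => i _; rewrite cabsM cabs_cis mulr1.
  have Pk : cabs (P - g k) <=
      \sum_(k' <- A | (k' != k) && (site_corr m k k' != 0)) cabs (g k').
    have -> : P - g k = \sum_(k' <- A | k' != k) g k' * site_corr m k k'.
      by rewrite /P (bigD1_seq k)//= site_corr_diag mulr1 addrAC subrr add0r.
    apply: le_trans (cabs_sum _ _ _) _; rewrite [leRHS]big_mkcondr.
    apply: ler_sum => k' _; rewrite cabsM; case: eqP => [->|_].
      by rewrite cabs0 mulr0.
    by rewrite ler_piMr ?cabs_ge0// cabs_site_corr_le.
  have : cabs (dfourier K z Delta f m k - g k) <=
      delta A + \sum_(k' <- A | (k' != k) && (site_corr m k k' != 0)) cabs (g k').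
    rewrite -(subrKA P); apply: le_trans (cabsD _ _) (lerD _ Pk).
    by rewrite -cabsN opprB.
  rewrite -lee_fin => /le_trans; apply; rewrite EFinD leeD2l//.
  rewrite -sumEFin -big_filter.
  pose s := [seq k' <- A | (k' != k) && (site_corr m k k' != 0)]; rewrite -/s.
  apply: esum_ge; exists [set` s].
    split=> [|k']; first exact: finite_seq.
    by rewrite /s /= mem_filter => /andP[/andP[]] + + _; exact: kS.
  by rewrite -fsbig_seq// filter_uniq// fset_uniq.
case: Y Y0 main => [y| |] // Y0 main; last by rewrite leey.
rewrite lee_fin; apply/ler_addgt0Pr => e e0.
(* Convergence along sets directed by inclusion allows [k] to be adjoined. *)
have [A [kA Ae]] : exists A, k \in A /\ delta A < e.
  have /cvgrPdist_lt/(_ _ e0)[A0 _ A0e] := delta0.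
  exists (k |` A0)%fset; rewrite fset1U1; split=> //.
  have := A0e (k |` A0)%fset (fsubsetU1 _ _); rewrite /= sub0r normrN.
  exact/le_lt_trans/ler_norm.
by have := main _ kA; rewrite lee_fin => /le_trans; apply; lra.
Qed.

End aliasing.

(** * From the cone conditions to the cubature error *)

Section error_bound.
Local Open Scope complex_scope.
Context (R : realType) (d : nat) (K : qmc_kind).
Variables (z : nat -> Rpoint R d) (Delta : Rpoint R d) (kt : nat -> wavenum K d).
Hypotheses (zK : node_sequence K z) (zDelta : proper_shift K z Delta).
Hypothesis zkt : wavenum_ordering z kt.
Implicit Types (f : Rpoint R d -> R).

(** Nonzero correlations occur only on the coset of [kt kappa] modulo the dual set, which the
    ordering enumerates with step [2 ^ m]; [lambda = 0] is [kt kappa] itself. *)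
Lemma dfourier_kt f m kappa : abs_conv_fourier K f -> (kappa < 2 ^ m)%N ->
  ((cabs (dfourier K z Delta f m (kt kappa) - fourier f (kt kappa)))%:E <=
   \sum_(1 <= lambda <oo) (cabs (fourier f (kt (kappa + lambda * 2 ^ m)%N)))%:E)%E.
Proof.
move=> fA km; have [kt_bij _ ktE] := zkt.
pose e lambda := kt (kappa + lambda * 2 ^ m)%N.
(* Injectivity lets the series over [lambda] be read as a sum over a set of wavenumbers. *)
have e_inj : injective e.
  move=> a b /(bij_inj kt_bij)/addnI/eqP.
  by rewrite eqn_pmul2r ?expn_gt0// => /eqP.
rewrite eseries_cond/=.
have -> : (\sum_(0 <= lambda <oo | (0 < lambda)%N)
     (cabs (fourier f (kt (kappa + lambda * 2 ^ m)%N)))%:E =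
   \esum_(k in [set e l | l in fun l => (0 < l)%N]) (cabs (fourier f k))%:E)%E.
  rewrite (@esum_pred_image _ _ (fun k => (cabs (fourier f k))%:E) e)//.
  - by move=> l _; rewrite lee_fin cabs_ge0.
  - by move=> a b _ _ /e_inj.
apply: dfourier_aliasing => // k' k'k.
rewrite /site_corr mulf_eq0 negb_or => /andP[_ /(sum_echar_site zK zDelta)[h hm k'E]].
have : [set kt (kappa + lambda * 2 ^ m)%N | lambda in [set: nat]] k'.
  by rewrite ktE//; exists h.
case=> l _ lk'; exists l => //=; rewrite lt0n; apply: contra k'k => /eqP l0.
by rewrite -lk' l0 mul0n addn0.
Qed.

Variables (lstar r : nat) (homega romega : nat -> R).
Hypotheses (homega_ge0 : forall m, 0 <= homega m) (romega_ge0 : forall m, 0 <= romega m).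
Hypothesis omega_lt1 : homega r * romega r < 1.
Variable f : Rpoint R d -> R.
Hypothesis fC : cone K kt lstar homega romega f.
Variable m : nat.
Hypothesis lm : (lstar + r <= m)%N.

Let l := (m - r)%N.

Lemma Scheck_le_Ssum : (Scheck K kt f m <= (romega r * Ssum K kt f l)%:E)%E.
Proof.
have [_ _ /(_ l m)] := fC; rewrite /l subKn; last lia.
by apply; lia.
Qed.

(** Passing from true to discrete coefficients costs at most [Shat], which the two cone conditions
    bound by [homega r * romega r] times [Ssum] itself. As that factor is below 1, the cost is
    absorbed on the left. *)
Lemma Ssum_le_Stilde :
  Ssum K kt f l <= Stilde K z Delta kt f l m / (1 - homega r * romega r).
Proof.
have [fA /(_ l m (leq_subr _ _)) Sh _] := fC.
rewrite ler_pdivlMr ?subr_gt0// mulrBr mulr1 lerBlDr -lee_fin.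
have le2 : (2 ^ l <= 2 ^ m)%N by rewrite leq_exp2l// leq_subr.
apply: (@le_trans _ _ ((Stilde K z Delta kt f l m)%:E + Shat K kt f l m)%E).
  rewrite /Ssum /Stilde /Shat -!sumEFin -big_split /=.
  rewrite big_nat_cond [leRHS]big_nat_cond; apply: lee_sum => kappa.
  rewrite andbT => /andP[_ kl]; have km := leq_trans kl le2.
  apply: le_trans (leeD2l _ (dfourier_kt fA km)).
  rewrite -EFinD lee_fin -[X in _ + X]cabsN; apply: le_trans (cabsD _ _).
  by rewrite opprB subrKC.
rewrite EFinD leeD2l//; apply: le_trans Sh _.
have -> : (m - l)%N = r by rewrite /l; lia.
rewrite mulrC -mulrA EFinM lee_wpmul2l ?lee_fin//.
exact: Scheck_le_Ssum.
Qed.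

Lemma fourier_wzero : fourier f (wzero K d) = (cube_int f)%:C.
Proof.
rewrite /fourier /cube_cint; congr (_ +i* _); rewrite /cube_int.
  apply: eq_Rintegral => x _.
  by rewrite pairing_wzero oppr0 cis0 mulr1.
rewrite /Rintegral integral0_eq// => x _.
by rewrite pairing_wzero oppr0 cis0 mulr1.
Qed.

Lemma dfourier_wzero : dfourier K z Delta f m (wzero K d) = (sample_mean K z Delta f m)%:C.
Proof.
rewrite /dfourier /sample_mean rmorphM fmorphV rmorphXn/= rmorph_nat; congr (_ * _).
by rewrite rmorph_sum; apply: eq_bigr => i _; rewrite pairing_wzero oppr0 cis0 mulr1.
Qed.

(** Integral and sample mean are the true and the discrete coefficient at wavenumber 0, so their
    difference is an aliasing error. *)
Lemma cubature_error :
  `|sample_mean K z Delta f m - cube_int f| <=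
  data_err K z Delta kt r homega romega f m.
Proof.
have [fA /(_ 0%N m (leq0n m)) Sh _] := fC; have [_ kt0 _] := zkt.
rewrite /data_err mulrAC -[leRHS]mulrA -/l.
rewrite -cabs_real rmorphB /= -fourier_wzero -dfourier_wzero -lee_fin -kt0.
apply: le_trans (dfourier_kt fA (expn_gt0 _ _)) _.
(* For [l = 0] the outer sum runs from [1./2 = 0] to 1, so [Shat] is exactly the aliasing series of
   [kappa = 0]. *)
move: Sh; rewrite /Shat subn0 big_nat1 => /le_trans; apply.
rewrite -mulrA EFinM lee_wpmul2l ?lee_fin//.
apply: le_trans Scheck_le_Ssum _; rewrite lee_fin ler_wpM2l//.
exact: Ssum_le_Stilde.
Qed.

End error_bound.

Theorem theorem1 (R : realType) (d : nat) (K : qmc_kind)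
  (z : nat -> Rpoint R d) (Delta : Rpoint R d) (kt : nat -> wavenum K d)
  (lstar r : nat) (homega romega : nat -> R)
  (p : nat) (f : 'I_p -> Rpoint R d -> R)
  (Omega : set 'rV[R]_p) (v : 'rV[R]_p -> R) (ea er : R) :
  (0 < d)%N ->
  injective z ->
  (forall j : 'I_d, (tnth (z 0%N) j : R) = 0) ->
  node_sequence K z ->
  @cube R d Delta ->
  proper_shift K z Delta ->
  wavenum_ordering z kt ->
  (0 < lstar)%N ->
  (forall m, 0 <= homega m) ->
  (forall m, 0 <= romega m) ->
  (exists M, forall m, homega m <= M) ->
  (exists M, forall m, romega m <= M) ->
  romega @ \oo --> (0 : R) ->
  homega r * romega r < 1 ->
  (0 < p)%N ->
  (forall j, cone K kt lstar homega romega (f j)) ->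
  0 <= ea -> 0 <= er -> er < 1 -> (ea, er) != (0, 0) ->
  let mu : 'rV[R]_p := \row_j cube_int (f j) in
  Omega mu ->
  let B m := err_box (\row_j sample_mean K z Delta (f j) m)
                 (\row_j data_err K z Delta kt r homega romega (f j) m) in
  let values m := [set v mu' | mu' in Omega `&` B m] in
  let vm m := inf (values m) in
  let vp m := sup (values m) in
  let vh m := vhat ea er (vm m) (vp m) in
  let finite_extremes m := has_lbound (values m) /\ has_ubound (values m) in
  (forall m, (lstar + r <= m)%N -> finite_extremes m ->
    [/\ ereal_inf [set ereal_sup [set tol ea er (v mu') v'' | mu' in Omega `&` B m]
                  | v'' in [set: R]] =
        ereal_inf [set ereal_sup [set tol ea er v' v'' | v' in `[vm m, vp m]]
                  | v'' in [set: R]],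
        ereal_inf [set ereal_sup [set tol ea er v' v'' | v' in `[vm m, vp m]]
                  | v'' in [set: R]] =
        ereal_sup [set tol ea er v' (vh m) | v' in `[vm m, vp m]],
        ereal_sup [set tol ea er v' (vh m) | v' in `[vm m, vp m]] =
        tol_opt ea er (vm m) (vp m),
        tol_at_endpoint ea er (vm m) (vp m) (vp m) (tol_opt ea er (vm m) (vp m)) &
        tol_at_endpoint ea er (vm m) (vp m) (vm m) (tol_opt ea er (vm m) (vp m))])
  /\
  (forall m0 m, (lstar + r <= m0)%N ->
    stops_at (fun m' => finite_extremes m' /\
                (tol_opt ea er (vm m') (vp m') <= 1)%E) m0 m ->
    (tol ea er (v mu) (vh m) <= 1)%E).
Proof.
move=> _ _ _ zK _ zD zkt _ hom0 rom0 _ _ _ omega1 _ fC ea0 er0 _ eaer mu Omu.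
move=> B values vm vp vh finite_extremes.
(* The cubature error bound in each coordinate places [mu] in the box. *)
have Vmu m : (lstar + r <= m)%N -> values m (v mu).
  move=> lm; exists mu => //; split=> // j; rewrite !mxE.
  have := cubature_error zK zD zkt hom0 rom0 omega1 (fC j) lm.
  by rewrite ler_distl lerBlDr andbC lerBlDr.
split=> [m lm [lV uV]|m0 m lm0 [m0m [[lV uV] crit] _]].
  have V0 : values m !=set0 by exists (v mu); exact: Vmu.
  have [infV infI supI] := tol_optimum ea0 er0 eaer V0 lV uV.
  have mp := inf_le_sup_value V0 lV uV.
  split.
  - rewrite infI -infV; congr ereal_inf; congr image; apply/funext => u.
    by rewrite /values image_comp.
  - by rewrite infI supI.
  - exact: supI.
  - by apply: tol_at_endpoint_opt => //; right.
  - by apply: tol_at_endpoint_opt => //; left.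
(* The true value lies between the extremes, so its tolerance is at most [tol_opt], which the
   stopping criterion bounds by 1. *)
apply: le_trans crit; apply: tol_vhat_le => //.
by apply: inf_le_value => //; apply: Vmu; exact: leq_trans m0m.
Qed.
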